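(* Let $(V,E)$ be a finite directed graph that is weakly connected, $w: E\to\mathbb R^+\setminus\{0\}$, $a: E\to\mathbb R$, $t>0$, $T_t = e^{-t\Delta_{w,a}/2}$, $S_t = (I-e^{-t\Delta_{w,a}})^{1/2}$, and let $\lambda_{\mathrm{max}}$ be the largest eigenvalue of $\Delta_{w,a}$. Let $f\in\ell^2(V)$ give rise to the sequence $(f_k,g_k)_{k=0}^\infty$ by the scattering transform, i.e. $f_0=0$, $g_0=f$, and $f_{k+1}=T_t|g_k|$, $g_{k+1}=S_t|g_k|$ for all $k\ge 0$. Then for each $k\in\mathbb N$ with $k \ge 1$, $$\| g_{k} \| = \| S_t |g_{k-1}| \| \le (1-e^{-t \lambda_{\mathrm{max}}})^{(k-1)/2} \| S_t |g_0| \| \le (1-e^{-t \lambda_{\mathrm{max}}})^{k/2} \| f \| .$$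
   Context: A directed graph $(V,E)$ consists of a finite vertex set $V$ and a set $E$ of ordered pairs of vertices. It is weakly connected if any two vertices appear in a sequence of adjacent edges when orientations are ignored. $\ell^2(V)$ is the real Hilbert space of all functions $f: V\to\mathbb R$ with $\langle f,g\rangle = \sum_{j\in V} f(j)g(j)$ and norm $\|f\|=\langle f,f\rangle^{1/2}$. $\Delta_{w,a}$ is the (positive semidefinite) self-adjoint operator on $\ell^2(V)$ corresponding to the quadratic form $\langle \Delta_{w,a} f,f\rangle = \sum_{(i,j)\in E} w(i,j)\,|e^{a(i,j)}f(i)-f(j)|^2$. The square root is that of a positive semidefinite operator. For a function $g$, $|g|$ denotes the pointwise absolute value, $|g|(i)=|g(i)|$. The convention $0^0=1$ is used. *)

(* Defs.v *)
From HB Require Import structures.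
From mathcomp Require Import all_boot all_order all_algebra.
From mathcomp Require Import all_classical all_reals all_analysis.
Set Implicit Arguments.
Unset Strict Implicit.
Unset Printing Implicit Defensive.
Import Order.TTheory GRing.Theory Num.Theory.
Import numFieldNormedType.Exports.
Local Open Scope classical_set_scope.
Local Open Scope ring_scope.

Definition weakly_connected (V : finType) (E : {set V * V}) : Prop :=
  forall x y : V,
    connect (fun u v => ((u, v) \in E) || ((v, u) \in E)) x y.

(* The codomain is R^o, so that l2 R V is a vectType and 'End(l2 R V) is the
   space of its linear operators. *)
Notation l2 R V := {ffun V -> R^o}.

Section Hilbert.
Context {R : realType} {V : finType}.
Implicit Types (f g : l2 R V) (A B : 'End(l2 R V)).

Definition inner f g : R := \sum_(j : V) (f j : R) * (g j : R).

Definition norm2 f : R := Num.sqrt (inner f f).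

Definition ptabs f : l2 R V := [ffun i => `|f i : R| : R^o].

Definition selfadjoint A : Prop := forall f g, inner (A f) g = inner f (A g).

Definition psd A : Prop := selfadjoint A /\ forall f, 0 <= inner (A f) f.

(* Every form q(f) = <A f, f> with A self-adjoint determines A, by
   polarization; 0 is a default value for all other q. *)
Definition operator_of_form (q : l2 R V -> R) : 'End(l2 R V) :=
  xget 0 [set A | selfadjoint A /\ forall f, inner (A f) f = q f].

(* The unique positive semidefinite square root of a positive semidefinite
   operator; 0 is a default value for all other A. *)
Definition sqrt_op A : 'End(l2 R V) :=
  xget 0 [set B | psd B /\ (B \o B)%VF = A].

(* e^A f = \sum_k A^k f / k!, the series being taken coordinatewise. *)
Definition exp_op A : 'End(l2 R V) :=
  linfun (fun f : l2 R V =>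
    [ffun v => limn (series (fun k : nat => (k`!%:R)^-1 * (iter k A f v : R)))
               : R^o] : l2 R V).

(* For V nonempty every self-adjoint operator has a largest eigenvalue; 0 is a
   default value. *)
Definition lambda_max A : R :=
  xget 0 [set l : R | passmx.leigenvalue A l /\
                      forall m : R, passmx.leigenvalue A m -> m <= l].

End Hilbert.

Definition Delta_form {R : realType} {V : finType} (E : {set V * V})
    (w a : V * V -> R) (f : l2 R V) : R :=
  \sum_(e in E) w e * `|expR (a e) * f e.1 - f e.2| ^+ 2.

Definition Delta {R : realType} {V : finType} (E : {set V * V})
    (w a : V * V -> R) : 'End(l2 R V) :=
  operator_of_form (Delta_form E w a).

Section Scattering.
Context {R : realType} {V : finType}.
Variables (E : {set V * V}) (w a : V * V -> R) (t : R).

Definition T_op : 'End(l2 R V) := exp_op (- (t / 2) *: Delta E w a).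

Definition S_op : 'End(l2 R V) :=
  sqrt_op (\1%VF - exp_op (- t *: Delta E w a)).

Fixpoint scattering (f : l2 R V) (k : nat) : l2 R V * l2 R V :=
  if k is k'.+1 then
    let g := (scattering f k').2 in (T_op (ptabs g), S_op (ptabs g))
  else (0, f).

End Scattering.

(* Main.v *)
(** In an orthonormal eigenbasis of the self-adjoint operator [Delta], with
    eigenvalues [0 <= l_u <= l_max], the operator [S^2 = 1 - exp(-t Delta)] is
    diagonal with entries [1 - exp(-t l_u) <= c := 1 - exp(-t l_max)]. Hence
    [|S h|^2 = <S^2 h, h> <= c |h|^2] for all [h]. As [|g|] has the same norm as
    [g], every step of the scattering transform gains a factor [c^(1/2)]. *)
Require Import Defs.
From HB Require Import structures.
From mathcomp Require Import all_boot all_order all_algebra.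
From mathcomp Require Import all_classical all_reals all_analysis.
From mathcomp Require Import complex ring lra.
Set Implicit Arguments.
Unset Strict Implicit.
Unset Printing Implicit Defensive.
Import Order.TTheory GRing.Theory Num.Theory.
Import numFieldNormedType.Exports.
Local Open Scope ring_scope.

(** * Inner product on real functions over a finite set *)

Section InnerProduct.
Context {R : realType} {V : finType}.
Implicit Types f g h : l2 R V.

Lemma innerC f g : inner f g = inner g f.
Proof. by apply: eq_bigr => j _; rewrite mulrC. Qed.

Lemma innerDl f g h : inner (f + g) h = inner f h + inner g h.
Proof.
by rewrite -big_split; apply: eq_bigr => j _; rewrite ffunE mulrDl.
Qed.

Lemma innerZl (c : R) f g : inner (c *: f) g = c * inner f g.
Proof. by rewrite mulr_sumr; apply: eq_bigr => j _; rewrite ffunE mulrA. Qed.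

Lemma inner0l g : inner 0 g = 0.
Proof. by rewrite -(scale0r 0) innerZl mul0r. Qed.

Lemma innerDr f g h : inner h (f + g) = inner h f + inner h g.
Proof. by rewrite innerC innerDl !(innerC h). Qed.

Lemma innerZr (c : R) f g : inner f (c *: g) = c * inner f g.
Proof. by rewrite innerC innerZl innerC. Qed.

Lemma inner_suml (I : Type) (r : seq I) (F : I -> l2 R V) g :
  inner (\sum_(i <- r) F i) g = \sum_(i <- r) inner (F i) g.
Proof.
by elim/big_rec2: _ => [|i x y _ <-]; rewrite ?inner0l ?innerDl.
Qed.

Lemma inner_ge0 f : 0 <= inner f f.
Proof. by apply: sumr_ge0 => j _; rewrite -expr2 sqr_ge0. Qed.

Lemma inner_eq0 f : (inner f f == 0) = (f == 0).
Proof.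
apply/eqP/eqP => [/psumr_eq0P f0|->]; last by rewrite inner0l.
apply/ffunP => j; rewrite ffunE; apply/eqP.
by rewrite -sqrf_eq0 expr2 f0// => i _; rewrite -expr2 sqr_ge0.
Qed.

Lemma inner_delta f i : inner f [ffun j => (j == i)%:R : R^o] = f i.
Proof.
rewrite /inner (bigD1 i)//= ffunE eqxx mulr1 big1 ?addr0// => j /negPf ji.
by rewrite ffunE ji mulr0.
Qed.

Lemma norm2_ptabs f : norm2 (ptabs f) = norm2 f.
Proof.
congr Num.sqrt; apply: eq_bigr => j _.
by rewrite !ffunE -!expr2 real_normK// num_real.
Qed.

End InnerProduct.

(** * Weighted sums of rank-one operators *)

Section FrameOperator.
Context {R : realType} {V : finType} {I : Type}.
Variables (r : seq I) (m : I -> R) (u : I -> l2 R V).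
Implicit Types f g : l2 R V.

(** The [u i] may be arbitrary vectors, orthogonal or not. The construction serves three times: for
    the projection onto a line, for functions of a diagonalized operator, and for the operator of
    the edge form. *)
Let frame_fun f : l2 R V := \sum_(i <- r) (m i * inner f (u i)) *: u i.

Let frame_fun_is_linear : linear frame_fun.
Proof.
move=> c f g; rewrite /frame_fun scaler_sumr -big_split; apply: eq_bigr => i _.
by rewrite innerDl innerZl mulrDr scalerDl scalerA mulrCA.
Qed.

HB.instance Definition _ :=
  GRing.isLinear.Build R (l2 R V) (l2 R V) _ frame_fun frame_fun_is_linear.

Definition frame_op : 'End(l2 R V) := linfun frame_fun.

Lemma frame_opE f : frame_op f = \sum_(i <- r) (m i * inner f (u i)) *: u i.
Proof. by rewrite lfunE. Qed.

Lemma inner_frame_op f g :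
  inner (frame_op f) g = \sum_(i <- r) m i * inner f (u i) * inner g (u i).
Proof.
rewrite frame_opE inner_suml; apply: eq_bigr => i _.
by rewrite innerZl (innerC g).
Qed.

Lemma frame_op_selfadjoint : selfadjoint frame_op.
Proof.
move=> f g; rewrite (innerC f) !inner_frame_op.
by apply: eq_bigr => i _; rewrite mulrAC.
Qed.

End FrameOperator.
Arguments frame_op {R V I}.

(** * Spectral theorem for self-adjoint operators *)

Section SpectralTheorem.
Context {R : realType} {V : finType}.
Implicit Types (f g : l2 R V) (A : 'End(l2 R V)) (U : {vspace l2 R V}).

(* [f + i g] is a complex eigenvector, for the eigenvalue [a + i b], of the matrix
   of [A] in a real basis of [U]. *)
Lemma invariant_complex_eigenvector A U : (A @: U <= U)%VS -> U != 0%VS ->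
  exists (a b : R) f g, [/\ f \in U, g \in U, (f != 0) || (g != 0),
    A f = a *: f - b *: g & A g = b *: f + a *: g].
Proof.
move=> AU U0.
pose e := vbasis U.
have eU : basis_of U e by exact: vbasisP.
(* Row [i] holds the coordinates of [A e_i], so coefficient vectors are rows and [A] acts on them by
   right multiplication with [M]. *)
pose M : 'M[R]_(\dim U) := \matrix_(i, j) coord e j (A e`_i).
have n0 : (0 < \dim U)%N by rewrite lt0n dimv_eq0.
have [z /eigenvalueP[x xM x0]] :=
  eigenvalue_closed (map_mx (real_complex R) M) n0.
pose cmb (p : 'I_(\dim U) -> R) : l2 R V := \sum_i p i *: e`_i.
have cmbU p : cmb p \in U.
  by apply: memv_suml => i _; apply: memvZ; rewrite vbasis_mem// mem_nth// size_tuple.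
have Acmb p : A (cmb p) = cmb (fun j => \sum_i p i * M i j).
  rewrite linear_sum /cmb.
  under [RHS]eq_bigr do rewrite scaler_suml.
  rewrite exchange_big; apply: eq_bigr => i _; rewrite linearZ/=.
  rewrite {1}(coord_basis eU (v := A e`_i)); last first.
    by rewrite (subvP AU)// memv_img// vbasis_mem// mem_nth// size_tuple.
  by rewrite scaler_sumr; apply: eq_bigr => j _; rewrite scalerA mxE.
have cmb_comb (c d : R) p q :
    cmb (fun j => c * p j + d * q j) = c *: cmb p + d *: cmb q.
  rewrite /cmb !scaler_sumr -big_split; apply: eq_bigr => i _.
  by rewrite scalerDl !scalerA.
have cmb_inj p : cmb p = 0 -> forall i, p i = 0.
  by have /freeP := basis_free eU; apply.
have xMj j : \sum_i x 0 i * (M i j)%:C%C = z * x 0 j.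
  have := congr1 (fun y : 'rV__ => y 0 j) xM; rewrite !mxE => <-.
  by apply: eq_bigr => i _; rewrite [in RHS]mxE.
exists (complex.Re z), (complex.Im z),
  (cmb (fun i => complex.Re (x 0 i))), (cmb (fun i => complex.Im (x 0 i))).
split=> //.
- rewrite -negb_and; apply: contra x0 => /andP[/eqP/cmb_inj p0 /eqP/cmb_inj q0].
  apply/eqP/rowP => i; rewrite mxE; apply/eqP; rewrite eq_complex.
  by rewrite p0 q0 !eqxx.
(* As [M] is real, the real and imaginary parts of [x M = z x] are the two required equations; the
   real part comes first. *)
- rewrite Acmb -scaleNr -cmb_comb; apply: eq_bigr => j _; congr (_ *: _).
  have /(congr1 (@complex.Re R)) := xMj j.
  rewrite raddf_sum; case: (z) (x 0 j) => [? ?] [? ?] /= E.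
  rewrite mulNr -E; apply: eq_bigr => i _.
  by case: (x 0 i) => ? ? /=; rewrite mulr0 subr0.
- rewrite Acmb -cmb_comb; apply: eq_bigr => j _; congr (_ *: _).
  have /(congr1 (@complex.Im R)) := xMj j.
  rewrite raddf_sum; case: (z) (x 0 j) => [? ?] [? ?] /= E.
  rewrite addrC -E; apply: eq_bigr => i _.
  by case: (x 0 i) => ? ? /=; rewrite mulr0 add0r.
Qed.

(** Self-adjointness makes the complex eigenvalue real, so the real and imaginary parts of the
    complex eigenvector both satisfy the real eigenvalue equation. One that is nonzero gets
    normalized. *)
Lemma selfadjoint_unit_eigenvector A U :
  selfadjoint A -> (A @: U <= U)%VS -> U != 0%VS ->
  exists f, [/\ f \in U, inner f f = 1 & A f = inner (A f) f *: f].
Proof.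
move=> Asa AU /(invariant_complex_eigenvector AU)[a [b [f [g]]]].
move=> [fU gU fg0 Af Ag].
have b0 : b = 0.
  (* Comparing [<A f, g>] with [<f, A g>] gives [b (|f|^2 + |g|^2) = 0]. *)
  have := Asa f g; rewrite Af Ag -scaleNr innerDl innerDr !innerZl !innerZr.
  move=> E; have {E} : b * (inner f f + inner g g) = 0 by lra.
  move/eqP; rewrite mulf_eq0 paddr_eq0 ?inner_ge0// !inner_eq0.
  by case/orP => [/eqP//|/andP[/eqP f0 /eqP g0]]; rewrite f0 g0 eqxx in fg0.
have [h [hU h0 Ah]] : exists h, [/\ h \in U, h != 0 & A h = a *: h].
  case/orP: fg0 => [f0|g0].
    by exists f; split; rewrite // Af b0 scale0r subr0.
  by exists g; split; rewrite // Ag b0 scale0r add0r.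
have hh : inner h h != 0 by rewrite inner_eq0.
have k1 : inner ((norm2 h)^-1 *: h) ((norm2 h)^-1 *: h) = 1.
  rewrite innerZl innerZr mulrA -expr2 exprVn sqr_sqrtr ?inner_ge0//.
  by rewrite mulVf.
exists ((norm2 h)^-1 *: h); split=> //; first exact: memvZ.
have -> : A ((norm2 h)^-1 *: h) = a *: ((norm2 h)^-1 *: h).
  by rewrite linearZ/= Ah !scalerA mulrC.
by rewrite innerZl k1 mulr1.
Qed.

(** Each [u] has norm 1, so its eigenvalue is [inner (A u) u] and no separate list of eigenvalues is
    carried along. *)
Definition orthonormal_eigenbasis A (s : seq (l2 R V)) :=
  [/\ uniq s, {in s &, forall u v, inner u v = (u == v)%:R},
      {in s, forall u, A u = inner (A u) u *: u} &
      forall f, f = \sum_(u <- s) inner f u *: u].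

(** Induction on the dimension of an invariant subspace [U]: split off a unit eigenvector [v] and
    continue in the orthogonal complement of [v] in [U]. *)
Theorem selfadjoint_eigenbasis A :
  selfadjoint A -> exists s, orthonormal_eigenbasis A s.
Proof.
move=> Asa.
suff gen U : (A @: U <= U)%VS -> exists s,
    [/\ {subset s <= U},
        uniq s, {in s &, forall u v, inner u v = (u == v)%:R},
        {in s, forall u, A u = inner (A u) u *: u} &
        {in U, forall f, f = \sum_(u <- s) inner f u *: u}].
  have [s [_ ? ? ? sf]] := gen fullv (subvf _).
  by exists s; split=> // f; apply: sf; exact: memvf.
have [n] := ubnP (\dim U); elim: n => // n IH in U *; rewrite ltnS => Un AU.
have [U0|U0] := eqVneq U 0%VS.
  exists [::]; split=> // f; rewrite U0 memv0 => /eqP->.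
  by rewrite big_nil.
have [v [vU vv Av]] := selfadjoint_unit_eigenvector Asa AU U0.
(* The orthogonal projection onto the line of [v]; its kernel provides the orthogonal complement as
   a subspace. *)
pose P : 'End(l2 R V) := frame_op [:: tt] (fun=> 1) (fun=> v).
have PE f : P f = inner f v *: v by rewrite frame_opE big_seq1 mul1r.
have v0 : v != 0 by rewrite -inner_eq0 vv oner_eq0.
have memW f : (f \in (U :&: lker P)%VS) = (f \in U) && (inner f v == 0).
  by rewrite memv_cap memv_ker PE scaler_eq0 (negPf v0) orbF.
have [||s [sW us on ev sp]] := IH (U :&: lker P)%VS.
- rewrite (leq_trans _ Un)// ltn_neqAle dimvS ?capvSl// andbT.
  apply: contraTneq vU => dimE.
  have /eqP/= <- : (U :&: lker P == U)%VS by rewrite eqEdim capvSl dimE leqnn.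
  by rewrite memW vv oner_eq0 andbF.
(* The complement is invariant: [<A f, v> = <f, A v>] is a multiple of [<f, v> = 0]. *)
- apply/subvP => _ /memv_imgP[f + ->]; rewrite !memW => /andP[fU /eqP fv].
  rewrite (subvP AU) ?memv_img//= Asa Av innerZr fv mulr0//.
have sv u : u \in s -> (u \in U) /\ inner u v = 0.
  by move=> /sW; rewrite memW => /andP[? /eqP].
have vs : v \notin s.
  by apply/negP => /sv[_ /eqP]; rewrite vv oner_eq0.
exists (v :: s); split.
- by move=> u; rewrite inE => /predU1P[->//|/sv[]].
- by rewrite /= vs.
- move=> x y; rewrite !inE => /predU1P[->|xs] /predU1P[->|ys].
  + by rewrite eqxx vv.
  + rewrite innerC (sv _ ys).2; case: eqP => // vy.
    by rewrite vy ys in vs.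
  + rewrite (sv _ xs).2; case: eqP => // xv.
    by rewrite -xv xs in vs.
  + exact: on.
- by move=> u; rewrite inE => /predU1P[->//|/ev].
- move=> f fU; rewrite big_cons.
  (* Removing the [v]-component lands in the complement and leaves the coefficients along [s]
     unchanged. *)
  have /sp E : f - inner f v *: v \in (U :&: lker P)%VS.
    rewrite memW memvB ?memvZ//= -scaleNr innerDl innerZl vv mulr1.
    by rewrite subrr.
  apply/eqP; rewrite addrC -subr_eq E; apply/eqP.
  apply: eq_big_seq => u us'.
  by rewrite -scaleNr innerDl innerZl (innerC v) (sv _ us').2 mulr0 addr0.
Qed.

End SpectralTheorem.

(** * Functional calculus in an orthonormal eigenbasis *)

Section FunctionalCalculus.
Context {R : realType} {V : finType}.
Variables (A : 'End(l2 R V)) (s : seq (l2 R V)).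
Hypothesis As : orthonormal_eigenbasis A s.
Implicit Types (phi psi : R -> R) (f g : l2 R V).

Definition fcalc phi : 'End(l2 R V) :=
  frame_op s (fun u => phi (inner (A u) u)) id.

Lemma parseval f : inner f f = \sum_(u <- s) inner f u ^+ 2.
Proof.
have [_ _ _ sp] := As.
rewrite {1}(sp f) inner_suml; apply: eq_bigr => u _.
by rewrite innerZl innerC -expr2.
Qed.

Lemma inner_fcalc phi f :
  inner (fcalc phi f) f = \sum_(u <- s) phi (inner (A u) u) * inner f u ^+ 2.
Proof.
by rewrite inner_frame_op; apply: eq_bigr => u _; rewrite -mulrA -expr2.
Qed.

Lemma inner_fcalc_eigenvector phi f u : u \in s ->
  inner (fcalc phi f) u = phi (inner (A u) u) * inner f u.
Proof.
have [us on _ _] := As => us'.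
rewrite inner_frame_op (bigD1_seq u)//= (on u u)// eqxx mulr1 big_seq_cond.
rewrite big1 ?addr0// => x /andP[xs xu].
by rewrite (on u x)// eq_sym (negPf xu) mulr0.
Qed.

Lemma fcalc_comp phi psi :
  (fcalc phi \o fcalc psi)%VF = fcalc (fun x => phi x * psi x).
Proof.
apply/lfunP => f; rewrite lfunE/= [LHS]frame_opE [RHS]frame_opE.
by apply: eq_big_seq => u us; rewrite inner_fcalc_eigenvector// mulrA.
Qed.

Lemma eq_fcalc phi psi :
  {in s, forall u, phi (inner (A u) u) = psi (inner (A u) u)} ->
  fcalc phi = fcalc psi.
Proof.
move=> E; apply/lfunP => f; rewrite !frame_opE.
by apply: eq_big_seq => u us; rewrite E.
Qed.

Lemma iter_eigenbasis (c : R) f k :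
  iter k (c *: A)%VF f =
  \sum_(u <- s) ((c * inner (A u) u) ^+ k * inner f u) *: u.
Proof.
have [_ _ ev sp] := As.
elim: k => [|k IH].
  by rewrite {1}(sp f); under [RHS]eq_bigr do rewrite mul1r.
rewrite iterS IH linear_sum; apply: eq_big_seq => u us.
have Au := ev _ us; set l := inner (A u) u in Au *.
by rewrite linearZ/= scale_lfunE Au !scalerA exprS; congr (_ *: _); ring.
Qed.

(** Expanding the iterates in the eigenbasis and exchanging finite sums turns each coordinate's
    partial sums into a finite combination of partial sums of scalar exponential series, which
    converge. *)
Lemma exp_op_fcalc (c : R) : exp_op (c *: A) = fcalc (fun x => expR (c * x)).
Proof.
(* Both sides are [linfun] of a function, so it suffices that these functions agree pointwise. *)
rewrite /fcalc /frame_op /exp_op; congr linfun; apply/funext => f.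
apply/ffunP => v; rewrite ffunE sum_ffunE.
apply: cvg_lim => //.
pose F n : R := \sum_(u <- s)
  (series (exp_coeff (c * inner (A u) u)) n * (inner f u * u v)).
have -> : series (fun k => k`!%:R^-1 * (iter k (c *: A)%VF f v : R)) = F.
  apply/funext => n; rewrite /F /series /=.
  under [RHS]eq_bigr do rewrite mulr_suml.
  rewrite exchange_big; apply: eq_bigr => k _.
  rewrite iter_eigenbasis sum_ffunE mulr_sumr; apply: eq_bigr => u _.
  by rewrite ffunE /exp_coeff /= -[_ *: u v]/(_ * u v); ring.
have -> : \sum_(u <- s) ((expR (c * inner (A u) u) * inner f u) *: u) v =
    \sum_(u <- s) expR (c * inner (A u) u) * (inner f u * u v).
  by apply: eq_bigr => u _; rewrite ffunE mulrA.
rewrite /F; apply: cvg_big => [|u _]; first exact: add_continuous.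
apply: cvgMr_tmp.
exact: is_cvg_series_exp_coeff.
Qed.

Lemma fcalc_id : A = fcalc id.
Proof.
apply/lfunP => f; have := iter_eigenbasis 1 f 1.
rewrite /= scale_lfunE scale1r frame_opE => ->.
by apply: eq_bigr => u _; rewrite mul1r expr1.
Qed.

Lemma one_sub_fcalc phi : \1%VF - fcalc phi = fcalc (fun x => 1 - phi x).
Proof.
have [_ _ _ sp] := As.
apply/lfunP => f; rewrite add_lfunE opp_lfunE id_lfunE !frame_opE.
rewrite {1}(sp f) -sumrB; apply: eq_bigr => u _.
by rewrite mulrBl mul1r scalerBl.
Qed.

Lemma inner_fcalc_ge0 phi f : {in s, forall u, 0 <= phi (inner (A u) u)} ->
  0 <= inner (fcalc phi f) f.
Proof.
move=> phi0; rewrite inner_fcalc big_seq; apply: sumr_ge0 => u us.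
by rewrite mulr_ge0 ?phi0 ?sqr_ge0.
Qed.

Lemma inner_fcalc_le phi (c : R) f :
  {in s, forall u, phi (inner (A u) u) <= c} ->
  inner (fcalc phi f) f <= c * inner f f.
Proof.
move=> phic; rewrite inner_fcalc parseval mulr_sumr !big_seq.
by apply: ler_sum => u us; rewrite ler_wpM2r ?sqr_ge0 ?phic.
Qed.

(** Applying the square root of [phi] to [A] exhibits a positive semidefinite root, so [xget] does
    not fall back on its default 0. *)
Lemma sqrt_op_fcalc phi : {in s, forall u, 0 <= phi (inner (A u) u)} ->
  psd (sqrt_op (fcalc phi)) /\
  (sqrt_op (fcalc phi) \o sqrt_op (fcalc phi))%VF = fcalc phi.
Proof.
move=> phi0; rewrite /sqrt_op; case: xgetP => [B _ //|].
move=> /(_ (fcalc (fun x => Num.sqrt (phi x))))[]; split; first split.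
- exact: frame_op_selfadjoint.
- by move=> f; apply: inner_fcalc_ge0 => u _; exact: sqrtr_ge0.
- by rewrite fcalc_comp; apply: eq_fcalc => u us; rewrite -expr2 sqr_sqrtr ?phi0.
Qed.

Lemma eigenbasis_leigenvalue u : u \in s ->
  passmx.leigenvalue A (inner (A u) u).
Proof.
have [_ on ev _] := As => us; apply/negP => /eqP E.
have : u \in passmx.leigenspace A (inner (A u) u).
  by rewrite memv_ker add_lfunE opp_lfunE scale_lfunE id_lfunE {1}ev// subrr.
rewrite E memv0 => /eqP u0; have := on u u us us.
by rewrite eqxx u0 inner0l => /eqP; rewrite eq_sym oner_eq0.
Qed.

End FunctionalCalculus.

(** * Largest eigenvalue *)

Section LargestEigenvalue.
Context {R : realType} {V : finType}.
Implicit Type A : 'End(l2 R V).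

Lemma leigenvalueP A (l : R) : passmx.leigenvalue A l ->
  exists2 f, f != 0 & A f = l *: f.
Proof.
move=> l0; exists (vpick (passmx.leigenspace A l)); first by rewrite vpick0.
have := memv_pick (passmx.leigenspace A l).
by rewrite memv_ker add_lfunE opp_lfunE scale_lfunE id_lfunE subr_eq0 => /eqP.
Qed.

(** An eigenvector [f] for [l] gives [0 <= <A f, f> = l <f, f>]; in the default case, as for empty
    [V], the value is 0. *)
Lemma lambda_max_ge0 A : psd A -> 0 <= lambda_max A.
Proof.
move=> [_ A0]; rewrite /lambda_max; case: xgetP => //= l _.
move=> [/leigenvalueP[f f0 Af] _].
have ff : 0 < inner f f by rewrite lt_def inner_eq0 f0 inner_ge0.
by have := A0 f; rewrite Af innerZl pmulr_lge0.
Qed.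

(** The largest eigenvalue occurring along [s] bounds every eigenvalue [m] of [A], since
    [m <f, f> = <A f, f>] for an eigenvector [f]. Hence a largest eigenvalue exists and [lambda_max]
    is not the default. *)
Lemma eigenbasis_le_lambda_max A s : orthonormal_eigenbasis A s ->
  {in s, forall u, inner (A u) u <= lambda_max A}.
Proof.
move=> As u us.
pose F (i : 'I_(size s)) := inner (A s`_i) s`_i.
have Fs x : x \in s -> exists i, inner (A x) x = F i.
  move=> xs; have xi : (index x s < size s)%N by rewrite index_mem.
  by exists (Ordinal xi); rewrite /F /= nth_index.
have [i0 _] := Fs _ us.
have [i _ imax] := Order.TotalTheory.arg_maxP (P := predT) F (erefl : predT i0).
have lmax x : x \in s -> inner (A x) x <= F i.
  by move=> /Fs[j ->]; exact: imax.
have [] : passmx.leigenvalue A (lambda_max A) /\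
    forall m, passmx.leigenvalue A m -> m <= lambda_max A.
  rewrite /lambda_max; case: xgetP => [l _ //|/(_ (F i))[]]; split.
    by apply: (eigenbasis_leigenvalue As); exact: mem_nth.
  move=> m /leigenvalueP[f f0 Af].
  have ff : 0 < inner f f by rewrite lt_def inner_eq0 f0 inner_ge0.
  have := inner_fcalc_le As (phi := id) f lmax.
  by rewrite -fcalc_id// Af innerZl ler_pM2r.
by move=> _; apply; exact: (eigenbasis_leigenvalue As).
Qed.

End LargestEigenvalue.

(** * The graph operator and the gain of one scattering step *)

Section Scattering.
Context {R : realType} {V : finType}.
Variables (E : {set V * V}) (w a : V * V -> R) (t : R).
Hypotheses (w_gt0 : forall e, e \in E -> 0 < w e) (t_gt0 : 0 < t).

Lemma Delta_psd : psd (Delta E w a).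
Proof.
have [] : selfadjoint (Delta E w a) /\
    forall f, inner (Delta E w a f) f = Delta_form E w a f.
  rewrite /Delta /operator_of_form; case: xgetP => [B _ //|].
  pose d i : l2 R V := [ffun j => (j == i)%:R : R^o].
  (* The edge term is [w e] times the square of the inner product of [f] with this vector, so [D]
     represents the form and rules out the default. *)
  pose D := frame_op (enum E) w (fun e => expR (a e) *: d e.1 - d e.2).
  move=> /(_ D)[]; split; first exact: frame_op_selfadjoint.
  move=> f; rewrite inner_frame_op big_enum; apply: eq_bigr => e _.
  rewrite -mulrA -expr2 -scaleN1r innerDr !innerZr !inner_delta mulN1r.
  by rewrite real_normK// num_real.
move=> sa form; split=> // f; rewrite form.
by apply: sumr_ge0 => e eE; rewrite mulr_ge0 ?exprn_ge0// ltW// w_gt0.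
Qed.

Let c := 1 - expR (- t * lambda_max (Delta E w a)).

Lemma contraction_ge0 : 0 <= c.
Proof.
rewrite subr_ge0 -expR0 ler_expR mulNr oppr_le0 mulr_ge0 ?(ltW t_gt0)//.
exact: lambda_max_ge0 Delta_psd.
Qed.

Lemma norm2_S_op_le f : norm2 (S_op E w a t f) <= c `^ (2^-1) * norm2 f.
Proof.
have [s Ds] := selfadjoint_eigenbasis Delta_psd.1.
rewrite powR12_sqrt ?contraction_ge0// -sqrtrM ?contraction_ge0//.
apply: ler_wsqrtr.
rewrite /S_op (exp_op_fcalc Ds) (one_sub_fcalc Ds).
set phi := fun x => 1 - _.
have phi0 : {in s, forall u, 0 <= phi (inner (Delta E w a u) u)}.
  move=> u _; rewrite subr_ge0 -expR0 ler_expR mulNr oppr_le0 mulr_ge0 ?(ltW t_gt0)//.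
  exact: Delta_psd.2.
have [[Ssa _] SS] := sqrt_op_fcalc Ds phi0.
(* [<S f, S f> = <S (S f), f>], and [1 - exp(-t x)] increases with [x], so its values on the
   spectrum are at most [c]. *)
rewrite -Ssa -comp_lfunE SS; apply: (inner_fcalc_le Ds) => u us.
rewrite lerD2l lerN2 ler_expR !mulNr lerN2 ler_pM2l//.
exact: (eigenbasis_le_lambda_max Ds).
Qed.

(** The first step is kept as [S |f|], so [k.+1] steps give only [k] factors. For [k = 0] and
    [c = 0] the convention [0^0 = 1] is used. *)
Lemma norm2_scattering_le f k :
  norm2 (scattering E w a t f k.+1).2
    <= c `^ (k%:R / 2) * norm2 (S_op E w a t (ptabs f)).
Proof.
elim: k => [|k IH]; first by rewrite mul0r powRr0 mul1r.
apply: (le_trans (norm2_S_op_le _)); rewrite norm2_ptabs.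
have -> : k.+1%:R / 2 = 2^-1 + k%:R / 2 :> R.
  by rewrite -natr1 mulrDl mul1r addrC.
(* To cover base 0, the exponent law asks for a nonzero sum of exponents; here it is at least
   [1/2]. *)
rewrite powRD; last first.
  by apply/implyP; rewrite paddr_eq0 ?divr_ge0 ?invr_ge0// invr_eq0 pnatr_eq0.
by rewrite -mulrA ler_wpM2l ?powR_ge0.
Qed.

End Scattering.

(** * Norm decay along the scattering sequence *)

Unset Implicit Arguments.

Theorem theorem3p3 (R : realType) (V : finType) (E : {set V * V})
    (w a : V * V -> R) (t : R) (f : l2 R V)
    (conn : weakly_connected E)
    (w_gt0 : forall e, e \in E -> 0 < w e)
    (t_gt0 : 0 < t) :
  let S := S_op E w a t in
  let lmax := lambda_max (Delta E w a) in
  let g := fun k : nat => (scattering E w a t f k).2 in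
  forall k : nat, (1 <= k)%N ->
    [/\ norm2 (g k) = norm2 (S (ptabs (g k.-1))),
        norm2 (S (ptabs (g k.-1)))
          <= (1 - expR (- t * lmax)) `^ ((k%:R - 1) / 2)
               * norm2 (S (ptabs (g 0%N)))
      & (1 - expR (- t * lmax)) `^ ((k%:R - 1) / 2)
               * norm2 (S (ptabs (g 0%N)))
          <= (1 - expR (- t * lmax)) `^ (k%:R / 2) * norm2 f].
Proof.
move=> S lmax g [//|k] _.
have -> : (k.+1%:R - 1) / 2 = k%:R / 2 :> R by rewrite -natr1 addrK.
split=> //; first exact: norm2_scattering_le.
have -> : k.+1%:R / 2 = k%:R / 2 + 2^-1 :> R by rewrite -natr1 mulrDl mul1r.
rewrite powRD; last first.
  apply/implyP; rewrite paddr_eq0 ?divr_ge0 ?invr_ge0//.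
  by rewrite invr_eq0 pnatr_eq0 andbF.
(* The remaining factor [c^(1/2)] comes from the first step, applied to [|f|], which has the norm of
   [f]. *)
rewrite -mulrA ler_wpM2l ?powR_ge0// -(norm2_ptabs f).
exact: norm2_S_op_le.
Qed.
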